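(* Let $m\ge 1$ be an integer, let $b_1,\dots,b_m$ be positive real numbers with $\sum_{j=1}^m b_j>1$, and let $m_1,\dots,m_m\ge 2$ be integers such that $\frac{\log m_j}{\log m_\ell}\notin\mathbb{Q}$ for some $j,\ell$. Let $s_0$ and $(\ell_j)_{j\ge0}$ be as defined in the context. Let $(a_n)_{n\ge 0}$ be a sequence of real random variables on a common probability space, and let $(X_n)_{n\ge 0}$ be defined by $X_0=a_0$ and $X_n=a_n+\sum_{j=1}^m b_j X_{\lfloor n/m_j\rfloor}$ for $n\ge 1$. Assume that at least one of the following two sets of assumptions holds: (A) $\sum_{j=1}^m \frac{b_j}{m_j}>1$ and the $a_n$ are integrable random variables with $\sup_{n\ge 1}\mathbb{E}|a_n|<+\infty$; (B) $\sum_{j=1}^m \frac{b_j}{m_j^2}>1$ and there exists $C>0$ such that for each $n\ge 1$ and each real $t\ge 1$, $\mathbb{P}(|a_n|>t)\le \frac{C}{t}$. Then $\frac{X_n}{n^{s_0}}$ converges almost surely, as $n\to+\infty$, to a random variable $L$ given as the sum of the random series $$L=\sum_{j=0}^{+\infty}\ell_j a_j.$$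
   Context: $\lfloor x\rfloor$ denotes the integer part of $x$. For $m$, $(b_i)$, $(m_i)$ as in the claim, $s_0$ denotes the positive root of the equation $\sum_{j=1}^m b_j m_j^{-s}=1$. The sequence $(\ell_j)_{j\ge 0}$ denotes the sequence of positive real numbers, depending only on $m$, $(b_i)$ and $(m_i)$, with the following property: for every deterministic real sequence $(a_n)_{n\ge0}$ with $\sum_{n\ge1}|a_n|n^{-s_0}<+\infty$, the sequence defined by $X_0=a_0$ and $X_n=a_n+\sum_{j=1}^m b_jX_{\lfloor n/m_j\rfloor}$ for $n\ge1$ satisfies $\lim_{n\to\infty}X_n/n^{s_0}=\sum_{j\ge0}\ell_ja_j$. (Such a sequence exists, by a theorem of the paper; it is unique, since $\ell_j$ is the limit of $X_n/n^{s_0}$ when $a_j=1$ and $a_i=0$ for $i\ne j$.) *)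

(* Defs.v *)
From HB Require Import structures.
From mathcomp Require Import all_boot all_order all_algebra.
From mathcomp Require Import all_classical all_reals all_analysis.

Set Implicit Arguments.
Unset Strict Implicit.
Unset Printing Implicit Defensive.

Import Order.TTheory GRing.Theory Num.Theory.
Import numFieldNormedType.Exports.

Local Open Scope classical_set_scope.
Local Open Scope ring_scope.

(* When 2 <= d j for all j, the indices n %/ d j are < n for 0 < n, so that for
   every a exactly one x satisfies this relation. *)
Definition divide_recurrence (R : realType) (m : nat) (b : 'I_m -> R)
    (d : 'I_m -> nat) (a x : nat -> R) : Prop :=
  x 0%N = a 0%N /\
  forall n : nat, (0 < n)%N ->
    x n = a n + \sum_(j < m) b j * x (n %/ d j)%N.

Definition growth_exponent (R : realType) (m : nat) (b : 'I_m -> R)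
    (d : 'I_m -> nat) (s : R) : Prop :=
  0 < s /\ \sum_(j < m) b j * (d j)%:R `^ (- s) = 1.

(* Sums of real series are limits of partial sums; the convergence of
   \sum_j ell j * a j is part of the property. There is at most one such ell
   for given b, d and s, by taking a to be the indicator of {j}. *)
Definition limit_coefficients (R : realType) (m : nat) (b : 'I_m -> R)
    (d : 'I_m -> nat) (s : R) (ell : nat -> R) : Prop :=
  (forall j, 0 < ell j) /\
  forall a x : nat -> R,
    (\sum_(1 <= n <oo) (`|a n| * n%:R `^ (- s))%:E < +oo)%E ->
    divide_recurrence b d a x ->
    exists l : R,
      series (fun j => ell j * a j) n @[n --> \oo] --> l /\
      x n / n%:R `^ s @[n --> \oo] --> l.

(* Main.v *)
Require Import Defs.
From HB Require Import structures.
From mathcomp Require Import all_boot all_order all_algebra.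
From mathcomp Require Import all_classical all_reals all_analysis.
From mathcomp Require Import measurable_realfun lra.

Set Implicit Arguments.
Unset Strict Implicit.
Unset Printing Implicit Defensive.

Import Order.TTheory GRing.Theory Num.Theory.
Import numFieldNormedType.Exports.

Local Open Scope classical_set_scope.
Local Open Scope ring_scope.

(** The deterministic limit theorem, which is what [limit_coefficients] says of
    [ell], applies to one sample [w] at a time as soon as the weighted series
    [\sum_n `|a n w| * n `^ (- s0)] converges. All the probability therefore
    lies in showing that this series converges almost surely.

    The function [s |-> \sum_j b j * d j `^ (- s)] is nonincreasing and equals
    1 at [s0], so its being larger than 1 at [k] means that [k < s0]
    ([growth_exponent_gt]). The two sets of assumptions thus give [1 < s0] and
    [2 < s0] respectively.
    - If the means [E|a n|] are bounded and [1 < s0], the weighted series has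
      finite expectation, hence is almost surely finite
      ([ae_summable_bounded_mean]).
    - If [P(|a n| > t) <= C / t] and [2 < s0], then
      [P(|a n| > n `^ (s0 / 2)) <= C * n `^ (- (s0 / 2))] is summable because
      [1 < s0 / 2]. By Borel-Cantelli, almost surely [|a n| <= n `^ (s0 / 2)]
      for [n] large, and then the weighted series is dominated by
      [\sum_n n `^ (- (s0 / 2))] ([ae_summable_weak_L1]).

    Both cases rest on the convergence of [\sum_n n `^ (- s)] for [1 < s]
    ([nneseries_powR_lty]). The limit is only defined almost everywhere;
    [pointwise_limit_RV] extends it to a random variable. *)

Lemma growth_exponent_gt (R : realType) (m : nat) (b : 'I_m -> R)
    (d : 'I_m -> nat) (k s : R) :
  (forall j, 0 < b j) -> (forall j, (1 <= d j)%N) ->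
  1 < \sum_(j < m) b j * (d j)%:R `^ (- k) ->
  growth_exponent b d s -> k < s.
Proof.
move=> b_gt0 d_ge1 k_sub [_ s_root]; rewrite ltNge; apply/negP => s_le_k.
move: k_sub; rewrite ltNge => /negP; apply; rewrite -[leRHS]s_root.
apply: ler_sum => j _; rewrite ler_pM2l//.
by apply: ler_powR; rewrite ?ler1n// lerN2.
Qed.

(** Cauchy's doubling argument in closed form: grouping the terms of ranks [2k]
    and [2k + 1], both at most [2 `^ (- s) * k `^ (- s)], bounds the partial sum
    [S (2n)] by [1 + 2 `^ (1 - s) * S n]. As [S n <= S (2n)] and
    [2 `^ (1 - s) < 1], this inequality bounds [S n] itself. *)
Lemma partial_sum_powR_le (R : realType) (s : R) (n : nat) : 1 < s ->
  \sum_(1 <= k < n) (k%:R : R) `^ (- s) <= (1 - 2 `^ (1 - s))^-1.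
Proof.
move=> s_gt1; pose f (k : nat) : R := k%:R `^ (- s).
pose S (k : nat) := \sum_(1 <= i < k) f i.
set q : R := 2 `^ (1 - s).
have q_lt1 : q < 1.
  rewrite -(powRr0 (2 : R)) /q /powR gt_eqF// ltr_expR.
  by rewrite ltr_pM2r ?ln_gt0 ?ltr1n//; lra.
have qE : q = 2 * 2 `^ (- s) by rewrite /q powRD ?powRr1// pnatr_eq0 implybT.
have double_le k : (0 < k)%N -> S k.*2 <= 1 + q * S k.
  elim: k => // k IH _; case: (posnP k) => [->|k_gt0].
    rewrite /S big_nat1 big_geq// mulr0 addr0.
    by rewrite /f powR1.
  have S_step i : (0 < i)%N -> S i.+1 = S i + f i.
    by move=> i_gt0; rewrite /S big_nat_recr.
  rewrite doubleS !S_step ?double_gt0//.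
  have f2k : f k.*2 = 2 `^ (- s) * f k.
    by rewrite /f -powRM// -natrM mul2n.
  have : f k.*2.+1 <= f k.*2.
    rewrite /f !powRN lef_pV2 ?posrE ?powR_gt0 ?ltr0n ?double_gt0//.
    by apply: ge0_ler_powR; rewrite ?nnegrE ?ler_nat//; lra.
  have -> : q * (S k + f k) = q * S k + 2 * f k.*2.
    by rewrite mulrDr f2k qE -!mulrA.
  by have := IH k_gt0; lra.
have S_le_double k : S k <= S k.*2.
  case: (posnP k) => [->//|k_gt0].
  rewrite /S (@big_cat_nat _ _ _ k 1 k.*2)//= ?lerDl ?sumr_ge0//; last first.
    by rewrite -addnn leq_addr.
  by move=> i _; exact: powR_ge0.
case: (posnP n) => [->|n_gt0].
  by rewrite big_geq// invr_ge0; lra.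
rewrite -[leRHS]mul1r ler_pdivlMr ?subr_gt0//.
by have := le_trans (S_le_double n) (double_le n n_gt0); rewrite -/(S n); lra.
Qed.

Lemma nneseries_powR_lty (R : realType) (s : R) : 1 < s ->
  (\sum_(1 <= n <oo) ((n%:R : R) `^ (- s))%:E < +oo)%E.
Proof.
move=> s_gt1; apply: (@le_lt_trans _ _ ((1 - 2 `^ (1 - s))^-1)%:E); last first.
  exact: ltry.
apply: lime_le.
  by apply: is_cvg_nneseries => n _ _; rewrite lee_fin powR_ge0.
by near=> n; rewrite sumEFin lee_fin partial_sum_powR_le.
Unshelve. all: by end_near. Qed.

Lemma ae_summable_bounded_mean (R : realType) (disp : measure_display)
    (T : measurableType disp) (P : probability T R) (a : nat -> {RV P >-> R})
    (s : R) :
  1 < s ->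
  (ereal_sup [set 'E_P[fun w => `|a n w|%R] | n in [set n : nat | (1 <= n)%N]]
      < +oo)%E ->
  {ae P, forall w,
    (\sum_(1 <= n <oo) (`|a n w| * n%:R `^ (- s))%:E < +oo)%E}.
Proof.
move=> s_gt1; set M := ereal_sup _ => M_lty.
pose f n w : \bar R := (`|a n w| * n%:R `^ (- s))%:E.
have f_ge0 n w : (0 <= f n w)%E by rewrite lee_fin mulr_ge0 ?powR_ge0.
have mf n : measurable_fun setT (f n).
  apply/measurable_EFinP; apply: measurable_funM => //.
  exact: measurableT_comp.
have Ef_le n : (1 <= n)%N ->
    (\int[P]_w f n w <= M * ((n%:R : R) `^ (- s))%:E)%E.
  move=> n_ge1; rewrite /f.
  under eq_integral do rewrite EFinM.
  rewrite ge0_integralZr//; last first.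
    by apply/measurable_EFinP; exact: measurableT_comp.
  apply: lee_wpmul2r; first by rewrite lee_fin powR_ge0.
  by apply: ereal_sup_ubound; exists n => //=; rewrite unlock.
have M_ge0 : (0 <= M)%E.
  apply: le_trans (ereal_sup_ubound _); last by exists 1%N.
  by rewrite unlock; apply: integral_ge0 => w _; rewrite lee_fin.
have M_fin : M \is a fin_num by rewrite ge0_fin_numE.
pose F w := (\sum_(1 <= n <oo) f n w)%E.
have FE w : F w = (\sum_(n <oo) f (n + 1)%N w)%E.
  by rewrite /F -(@nneseries_addn _ (f ^~ w) 1%N).
have mF : measurable_fun setT F.
  rewrite (_ : F = fun w => \sum_(n <oo) f (n + 1)%N w)%E; last exact/funext.
  by apply: ge0_emeasurable_sum.
have F_ge0 w : (0 <= F w)%E by exact: nneseries_ge0.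
have intF : (\int[P]_w F w < +oo)%E.
  under eq_integral do rewrite FE.
  rewrite integral_nneseries//.
  apply: (@le_lt_trans _ _
    (\sum_(n <oo) M * (((n + 1)%:R : R) `^ (- s))%:E)%E).
    apply: lee_nneseries => [n _ _|n _]; first exact: integral_ge0.
    by apply: Ef_le; rewrite addn1.
  rewrite -(fineK M_fin) nneseriesZl; last first.
    by move=> n _; rewrite lee_fin powR_ge0.
  rewrite lte_mul_pinfty ?lee_fin ?fine_ge0//.
  rewrite (@nneseries_addn _ (fun n => ((n%:R : R) `^ (- s))%:E) 1%N).
    exact: nneseries_powR_lty.
  by move=> n; rewrite lee_fin powR_ge0.
have F_int : P.-integrable setT F.
  by apply/integrableP; split => //; under eq_integral do rewrite gee0_abs//.
have := integrable_ae measurableT F_int.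
by apply: filterS => w /(_ I); rewrite ge0_fin_numE.
Qed.

(** Variables with such tails need not have a mean, so the expectation of the
    series is of no use; the threshold [n `^ (s / 2)] splits the exponent
    evenly, so that the same series [\sum_n n `^ (- (s / 2))] controls the
    probability of exceeding the threshold and the terms that do not exceed
    it. *)
Lemma ae_summable_weak_L1 (R : realType) (disp : measure_display)
    (T : measurableType disp) (P : probability T R) (a : nat -> {RV P >-> R})
    (s C : R) :
  2 < s ->
  (forall (n : nat) (t : R), (1 <= n)%N -> 1 <= t ->
    (P [set w | (t < `|a n w|)%R] <= (C / t)%:E)%E) ->
  {ae P, forall w,
    (\sum_(1 <= n <oo) (`|a n w| * n%:R `^ (- s))%:E < +oo)%E}.
Proof.
move=> s_gt2 tail; pose u := s / 2.
have u_gt1 : 1 < u by rewrite /u; lra.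
(* The index is shifted because the tail bound is only assumed from rank 1. *)
pose F (n : nat) := [set w | (n.+1%:R `^ u < `|a n.+1 w|)%R].
have mF n : measurable (F n).
  rewrite (_ : F n = (fun w => `|a n.+1 w|) @^-1` `]n.+1%:R `^ u, +oo[%classic).
    rewrite -[X in measurable X]setTI.
    have : measurable_fun setT (fun w => `|a n.+1 w|) by exact: measurableT_comp.
    by apply => //; exact: measurable_itv.
  by apply/seteqP; split => w /=; rewrite in_itv/= andbT.
have F_sum : (\sum_(n <oo) P (F n) < +oo)%E.
  apply: (@le_lt_trans _ _
    (\sum_(n <oo) C%:E * (((n + 1)%:R : R) `^ (- u))%:E)%E).
    apply: lee_nneseries => [n _ _|n _]; first exact: measure_ge0.
    rewrite addn1 powRN -EFinM; apply: tail => //.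
    by apply: le_trans (le1r_powR _ _); rewrite ?ler1n// ltW.
  have C_ge0 : 0 <= C.
    have := le_trans (measure_ge0 P _) (tail 1%N 1 isT (lexx _)).
    by rewrite lee_fin divr1.
  rewrite nneseriesZl; last by move=> n _; rewrite lee_fin powR_ge0.
  rewrite lte_mul_pinfty ?lee_fin//.
  rewrite (@nneseries_addn _ (fun n => ((n%:R : R) `^ (- u))%:E) 1%N).
    exact: nneseries_powR_lty.
  by move=> n; rewrite lee_fin powR_ge0.
exists (lim_sup_set F); split.
- by apply: bigcap_measurable => // n _; exact: bigcup_measurable.
- exact: lim_sup_set_cvg0.
(* Goal by contraposition: if the weighted series diverges at [w], then [w]
   exceeds the threshold beyond every rank [N]. *)
move=> w /= w_inf N _; apply: contrapT => notF; apply: w_inf.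
have a_le n : (N < n)%N -> `|a n w| <= n%:R `^ u.
  case: n => // n Nn; rewrite leNgt; apply/negP => large.
  by apply: notF; exists n.
have term_ge0 n : (0 <= (`|a n w| * n%:R `^ (- s))%:E)%E.
  by rewrite lee_fin mulr_ge0 ?powR_ge0.
rewrite (@nneseries_split _ _ 1 N)// lte_add_pinfty//.
  by rewrite sumEFin ltry.
apply: (@le_lt_trans _ _ (\sum_(1 + N <= n <oo) ((n%:R : R) `^ (- u))%:E)%E).
  have summand_le n : (N < n)%N ->
      `|a n w| * n%:R `^ (- s) <= n%:R `^ (- u).
    move=> Nn; have n_neq0 : (n%:R : R) != 0.
      by rewrite pnatr_eq0 -lt0n (leq_ltn_trans _ Nn).
    rewrite (_ : - u = u - s); last by rewrite /u; lra.
    by rewrite powRD ?n_neq0 ?implybT// ler_wpM2r ?powR_ge0// a_le.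
  rewrite ereal_series [leRHS]ereal_series.
  by apply: lee_nneseries => // n Nn; rewrite lee_fin summand_le.
apply: le_lt_trans (nneseries_powR_lty u_gt1).
rewrite [leRHS](@nneseries_split _ _ 1 N)//.
by apply: leeDr; apply: sume_ge0 => n _; rewrite lee_fin powR_ge0.
Qed.

(** The upper limit in the extended reals is measurable without any
    hypothesis of convergence or boundedness, so [fine] of it is a random
    variable that agrees with the limit wherever a finite one exists. *)
Lemma pointwise_limit_RV (R : realType) (disp : measure_display)
    (T : measurableType disp) (P : probability T R) (u : nat -> T -> R) :
  (forall n, measurable_fun setT (u n)) ->
  exists L : {RV P >-> R}, forall w (l : R),
    u n w @[n --> \oo] --> l -> L w = l.
Proof.
move=> mu; pose L w : R := fine (limn_esup (fun n => (u n w)%:E)).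
have mL : measurable_fun setT L.
  apply: (measurableT_comp (@fine_measurable R setT measurableT)).
  by apply: measurable_fun_limn_esup => n; apply/measurable_EFinP.
pose mLE := @isMeasurableFun.Build _ _ T R L mL.
pose L' : {RV P >-> R} := HB.pack L mLE.
exists L' => w l cvg_l; rewrite /= /L.
have : (u n w)%:E @[n --> \oo] --> l%:E.
  by apply: cvg_EFin; [exact: nearW | exact: cvg_l].
by move=> /cvg_limn_einf_sup[_ ->].
Qed.

Theorem theorem2 (R : realType) (m : nat) (b : 'I_m -> R) (d : 'I_m -> nat)
    (s0 : R) (ell : nat -> R)
    (disp : measure_display) (T : measurableType disp) (P : probability T R)
    (a : nat -> {RV P >-> R}) (X : nat -> T -> R) :
  (1 <= m)%N ->
  (forall j, 0 < b j) ->
  1 < \sum_(j < m) b j ->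
  (forall j, (2 <= d j)%N) ->
  (exists j l : 'I_m, irrational (ln ((d j)%:R : R) / ln ((d l)%:R : R))) ->
  growth_exponent b d s0 ->
  limit_coefficients b d s0 ell ->
  (forall w : T, divide_recurrence b d (fun n => a n w) (fun n => X n w)) ->
  (1 < \sum_(j < m) b j / (d j)%:R /\
   (forall n, P.-integrable [set: T] (EFin \o a n)) /\
   (ereal_sup [set 'E_P[fun w => `|a n w|%R] | n in [set n : nat | (1 <= n)%N]]
      < +oo)%E)
  \/
  (1 < \sum_(j < m) b j / (d j)%:R ^+ 2 /\
   exists C : R, 0 < C /\
     forall (n : nat) (t : R), (1 <= n)%N -> 1 <= t ->
       (P [set w | (t < `|a n w|)%R] <= (C / t)%:E)%E) ->
  exists L : {RV P >-> R},
    {ae P, forall w : T,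
      series (fun j => ell j * a j w) n @[n --> \oo] --> L w /\
      X n w / n%:R `^ s0 @[n --> \oo] --> L w}.
Proof.
move=> _ b_gt0 _ d_ge2 _ s0_exp [_ ell_lim] X_rec moments.
have d_ge1 j : (1 <= d j)%N by exact: ltnW.
have ae_summable : {ae P, forall w,
    (\sum_(1 <= n <oo) (`|a n w| * n%:R `^ (- s0))%:E < +oo)%E}.
  case: moments => [[sum_gt1 [_ bounded]]|[sum_gt1 [C [_ tail]]]].
  - apply: ae_summable_bounded_mean bounded.
    apply: growth_exponent_gt s0_exp => //.
    by under eq_bigr do rewrite powR_inv1//.
  - apply: ae_summable_weak_L1 tail.
    apply: growth_exponent_gt s0_exp => //.
    by under eq_bigr do rewrite powR_invn//.
have m_series n :
    measurable_fun setT (fun w => series (fun j => ell j * a j w) n).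
  by apply: measurable_sum => j; exact: measurable_funM.
have [L L_lim] := pointwise_limit_RV P m_series.
exists L; move: ae_summable; apply: filterS => w w_summable.
have [l [series_l X_l]] := ell_lim _ _ w_summable (X_rec w).
by rewrite (L_lim w l series_l).
Qed.
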